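(* Let $d\ge 1$ and $n\ge 1$ be integers, and let $P\in\mathbb C[z_1,\ldots,z_d]$ be a homogeneous polynomial of degree $n$ that is not identically zero. If $|P|$ restricted to the unit sphere $S^{2d-1}\subset\mathbb C^d$ attains its maximum at a point $p\in S^{2d-1}$, then $p$ is at angular distance at least $\arcsin\frac{1}{\sqrt n}$ from the intersection of the zero set of $P$ with $S^{2d-1}$.
   Context: $S^{2d-1}=\{z\in\mathbb C^d : |z_1|^2+\cdots+|z_d|^2=1\}$. The angular distance between $u,v\in S^{2d-1}$ is the angle between them as unit vectors of $\mathbb C^d\cong\mathbb R^{2d}$, i.e. $\arccos\left(\mathrm{Re}\sum_j u_j\overline{v_j}\right)\in[0,\pi]$. ''The point $p$ is at angular distance at least $r$ from a set $Z$'' means that every $z\in Z$ is at angular distance at least $r$ from $p$ (vacuously true if $Z$ is empty). *)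

(* Defs.v *)
From HB Require Import structures.
From mathcomp Require Import all_boot all_order all_algebra.
From mathcomp Require Import complex.
From mathcomp Require Import classical_sets reals trigo.
(* The notations of [mpoly] clash with those of [classical_sets]. *)
From mathcomp Require Import -(notations) mpoly.

Set Implicit Arguments.
Unset Strict Implicit.
Unset Printing Implicit Defensive.

Import Order.TTheory GRing.Theory Num.Theory.

Local Open Scope classical_set_scope.
Local Open Scope ring_scope.
Local Open Scope complex_scope.

Section Sphere.
Context {R : realType} {d : nat}.
Implicit Types (u v p : 'rV[R[i]]_d) (P : mpoly d R[i]).

Definition peval P u : R[i] := meval (fun j => u 0 j) P.

Definition homogeneous (n : nat) P : bool :=
  P \is ishomog1 n mdeg.

(* The moduli and this equation live in [R[i]]; the sum is a nonnegative real. *)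
Definition unit_sphere : set 'rV[R[i]]_d :=
  [set u | \sum_j `|u 0 j| ^+ 2 = 1].

Definition zero_set P : set 'rV[R[i]]_d := [set u | peval P u = 0].

Definition angular_dist u v : R :=
  acos (complex.Re (\sum_j u 0 j * (v 0 j)^*)).

Definition at_angular_dist_ge p (r : R) (Z : set 'rV[R[i]]_d) : Prop :=
  forall z, Z z -> r <= angular_dist p z.

(* Moduli are compared in the partial order of [R[i]], which on real elements
   is the usual order. *)
Definition max_modulus_at P p : Prop :=
  unit_sphere p /\ forall u, unit_sphere u -> `|peval P u| <= `|peval P p|.

End Sphere.

(* Main.v *)
Require Import Defs.
From HB Require Import structures.
From mathcomp Require Import all_boot all_order all_algebra.
From mathcomp Require Import separable cyclotomic cyclic complex.
From mathcomp Require Import classical_sets reals trigo.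
From mathcomp Require Import -(notations) mpoly.
From mathcomp Require Import ring lra.

Import Order.TTheory GRing.Theory Num.Theory.

Local Open Scope classical_set_scope.
Local Open Scope ring_scope.

(** Why the theorem is true.  Let [z] be a zero of [P] on the sphere, let [y] be
    the Hermitian product of [p] and [z], and let [w = p - y z] be the component
    of [p] orthogonal to [z], so that [|w|^2 = b] with [b = 1 - |y|^2].  On the
    complex line through [y z] with direction [w], the polynomial
    [q(t) = P(t w + y z)] satisfies [q(1) = P(p)], and [q(0) = y^n P(z) = 0].
    Because [P] is homogeneous and [|P|] is maximal at [p],
    [|q(t)|^2 <= |P(p)|^2 (1 - b + b |t|^2)^n] for every [t].

    The complex structure enters through the maximum principle applied to
    [h(t) = q(t) / t], a polynomial since [q(0) = 0].  For [T > 1] it gives a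
    point of the circle [|t| = T] at which [|h| >= |h(1)| = |P(p)|], that is
    [|q| >= T |P(p)|].  As [P(p)] is nonzero, [T^2 <= (1 - b + b T^2)^n] for all
    [T > 1] ([growth_along_line]); comparing slopes at [T = 1] yields [1 <= n b]
    ([one_le_of_growth]).  Hence [|y|^2 <= 1 - 1/n] ([sqr_hdot_le]), and the
    cosine [Re y] of the angle between [p] and [z] is at most
    [sqrt (1 - 1/n) = cos (arcsin (1 / sqrt n))].

    The maximum principle and the fact that a nonzero polynomial has a nonzero
    value are both obtained by averaging over roots of unity
    ([sum_primitive_root]), which isolates a single coefficient. *)

(** * Roots of unity and the maximum principle *)

Lemma exists_primitive_root (C : numClosedFieldType) (N : nat) :
  (0 < N)%N -> exists w : C, N.-primitive_root w.
Proof.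
move=> N0; pose p : {poly C} := 'X^N - 1.
have mon : p \is monic by rewrite /p monicXnsubC.
have [r def_p] := closed_field_poly_normal p.
move: def_p; rewrite (monicP mon) scale1r => def_p.
have szr : size r = N.
  by apply: succn_inj; rewrite -(size_prod_XsubC _ id) -def_p size_XnsubC.
have Ur : uniq r.
  rewrite -separable_prod_XsubC -def_p separable_Xn_sub_1 //.
  by rewrite pnatr_eq0 -lt0n.
have rootsr : all N.-unity_root r.
  by apply/allP => z zr; rewrite /root_of_unity -/p def_p root_prod_XsubC.
have /hasP[w _ prim_w] := has_prim_root N0 rootsr Ur (eq_leq (esym szr)).
by exists w.
Qed.

(** Orthogonality of characters: [(w^a / w^b) ^ k], summed over [k], is a
    geometric sum whose ratio is an [N]-th root of unity. *)
Lemma sum_primitive_root (C : numClosedFieldType) (N : nat) (w : C)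
    (a b : nat) : N.-primitive_root w -> (a < N)%N -> (b < N)%N ->
  \sum_(k < N) (w ^+ k) ^+ a / (w ^+ k) ^+ b = if a == b then N%:R else 0.
Proof.
move=> prim aN bN.
have w0 : w != 0.
  apply/eqP => w0; have := prim_expr_order prim.
  rewrite w0 expr0n gtn_eqF ?(prim_order_gt0 prim)// => /eqP.
  by rewrite eq_sym oner_eq0.
under eq_bigr => k _ do
  rewrite -!exprM !(mulnC k) !exprM -exprVn -exprMn.
have [->|ab] := eqVneq a b.
  under eq_bigr do rewrite divff ?expf_neq0// expr1n.
  by rewrite sumr_const card_ord.
have xN1 : w ^+ a / w ^+ b != 1.
  rewrite -subr_eq0 -(mulfV (expf_neq0 b w0)) -mulrBl mulf_neq0 ?invr_eq0
    ?expf_neq0// subr_eq0 (eq_prim_root_expr prim) !modn_small//.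
apply: (mulfI (x := w ^+ a / w ^+ b - 1)); first by rewrite subr_eq0.
rewrite mulr0 -subrX1 exprMn exprVn -!exprM !(mulnC _ N) !exprM.
by rewrite (prim_expr_order prim) !expr1n divr1 subrr.
Qed.

Lemma normr_primitive_root (C : numClosedFieldType) (N : nat) (w : C) :
  N.-primitive_root w -> `|w| = 1.
Proof.
move=> prim; apply: (@pexpIrn _ N); rewrite ?nnegrE ?(prim_order_gt0 prim)//.
by rewrite expr1n -normrX (prim_expr_order prim) normr1.
Qed.

(** Cauchy's estimate, the contour integral being replaced by an average over
    the [N]-th roots of unity, which is exact when [N] exceeds the degree. *)
Lemma coef_le_circle (C : numClosedFieldType) (q : {poly C}) (T M : C) :
  0 <= T -> (forall z, `|z| = T -> `|q.[z]| <= M) ->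
  forall k, `|q`_k| * T ^+ k <= M.
Proof.
move=> T0 bnd k.
have M0 : 0 <= M by apply: le_trans (bnd T _); rewrite ?normr_ge0 ?ger0_norm.
have [kN|kN] := ltnP k (size q); last by rewrite nth_default// normr0 mul0r.
set N := size q in kN.
have N0 : (0 < N)%N by case: (N) kN.
have [w prim] := exists_primitive_root C N N0.
have nw := normr_primitive_root _ _ _ prim.
have avg : \sum_(j < N) q.[T * w ^+ j] / (w ^+ j) ^+ k = N%:R * (q`_k * T ^+ k).
  under eq_bigr => j _.
    rewrite horner_coef -/N mulr_suml.
    under eq_bigr => i _ do rewrite exprMn (mulrA q`_i) -mulrA.
    over.
  rewrite exchange_big /=.
  under eq_bigr => i _.
    rewrite -mulr_sumr (sum_primitive_root _ _ _ _ _ prim)//.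
    over.
  rewrite (bigD1 (Ordinal kN))//= eqxx big1 ?addr0 1?mulrC//.
  by move=> i; rewrite -val_eqE /= => /negbTE ->; rewrite mulr0.
have N0C : 0 < N%:R :> C by rewrite ltr0n.
rewrite -(ler_pM2l N0C) -{1}(ger0_norm T0) -normrX -normrM.
rewrite -{1}(@ger0_norm _ N%:R) ?ler0n// -normrM -avg.
apply: (le_trans (ler_norm_sum _ _ _)).
rewrite mulr_natl -[N in leRHS]card_ord -sumr_const; apply: ler_sum => j _.
rewrite normrM normfV !normrX nw !expr1n invr1 mulr1.
by apply: bnd; rewrite normrM normrX nw expr1n mulr1 ger0_norm.
Qed.

(** The maximum principle up to a constant: by Cauchy's estimate the terms of
    [q.[1]] are dominated by a geometric series of ratio [T^-1]. *)
Lemma weak_maximum_modulus (C : numClosedFieldType) (q : {poly C}) (T M : C) :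
  1 < T -> (forall z, `|z| = T -> `|q.[z]| <= M) ->
  `|q.[1]| * (1 - T^-1) <= M.
Proof.
move=> T1 bnd.
have T0 : 0 < T by apply: lt_trans T1; exact: ltr01.
have coefs := coef_le_circle _ q T M (ltW T0) bnd.
have M0 : 0 <= M.
  by apply: le_trans (bnd T _); rewrite ?normr_ge0 ?ger0_norm ?ltW.
have TV1 : 0 <= 1 - T^-1 by rewrite subr_ge0 invf_le1 ?ltW.
have step : `|q.[1]| <= \sum_(k < size q) M * T^-1 ^+ k.
  rewrite horner_coef; apply: (le_trans (ler_norm_sum _ _ _)).
  apply: ler_sum => k _; rewrite expr1n mulr1 exprVn ler_pdivlMr ?exprn_gt0//.
apply: (le_trans (ler_wpM2r TV1 step)).
rewrite -mulr_sumr -mulrA ler_piMr//.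
rewrite mulrC -opprB mulNr -subrX1 opprB gerBl ?exprn_ge0// invr_ge0 ltW//.
Qed.

(** Bernoulli's inequality makes the powers of a number greater than 1
    unbounded. *)
Lemma le1_bounded_powers (R : realType) (x k : R) :
  0 < k -> 0 <= x -> (forall N : nat, x ^+ N * k <= 1) -> x <= 1.
Proof.
move=> k0 x0 bnd; rewrite leNgt; apply/negP => x1.
have bern N : 1 + N%:R * (x - 1) <= x ^+ N.
  elim: N => [|N IH]; first by rewrite mul0r addr0 expr0.
  rewrite exprS; apply: le_trans (ler_wpM2l x0 IH).
  rewrite -natr1; have : 0 <= N%:R * (x - 1) ^+ 2 by rewrite mulr_ge0 ?sqr_ge0.
  nra.
have d0 : 0 < (x - 1) * k by nra.
have := archi_boundP (ltW (divr_gt0 ltr01 d0)).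
set N := Num.bound _; rewrite ltr_pdivrMr// => HN.
have := bnd N; have := bern N => h1 h2.
have := ler_wpM2r (ltW k0) h1; nra.
Qed.

(** The constant lost in [weak_maximum_modulus] depends only on [T], not on the
    degree, so applying that bound to all powers of [q] and taking roots removes
    it. *)
Lemma maximum_modulus_at_1 (R : realType) (q : {poly R[i]}) (T M : R[i]) :
  1 < T -> (forall z, `|z| = T -> `|q.[z]| <= M) -> `|q.[1]| <= M.
Proof.
move=> T1 bnd.
have T0 : 0 < T by apply: lt_trans T1; exact: ltr01.
have M0 : 0 <= M.
  by apply: le_trans (bnd T _); rewrite ?normr_ge0 ?ger0_norm ?ltW.
have TV1 : 0 < 1 - T^-1 by rewrite subr_gt0 invf_lt1.
have pow N : `|q.[1]| ^+ N * (1 - T^-1) <= M ^+ N.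
  have /(weak_maximum_modulus _ (q ^+ N) T (M ^+ N) T1) :
      forall z, `|z| = T -> `|(q ^+ N).[z]| <= M ^+ N.
    by move=> z zT; rewrite horner_exp normrX lerXn2r ?nnegrE// bnd.
  by rewrite horner_exp normrX.
have [M_eq0|M_neq0] := eqVneq M 0.
  have := pow 1%N; rewrite !expr1 M_eq0 pmulr_lle0//.
have Mpos : 0 < M by rewrite lt_def M_neq0.
have x0 : 0 <= `|q.[1]| / M by rewrite divr_ge0.
rewrite -[leRHS]mul1r -ler_pdivrMr//.
have /complex_realP[x xE] := ger0_real x0.
have /complex_realP[k kE] := gtr0_real TV1.
rewrite xE -(rmorph1 (real_complex R)) lecR.
apply: (@le1_bounded_powers _ x k).
- by rewrite -ltcR -kE.
- by rewrite -lecR -xE.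
- move=> N; rewrite -lecR rmorphM rmorphXn /= -xE -kE rmorph1.
  by rewrite exprMn exprVn mulrAC ler_pdivrMr ?exprn_gt0// mul1r.
Qed.

(** * The Hermitian sphere *)

Definition sqnorm {R : realType} {d : nat} (u : 'rV[R[i]]_d) : R[i] :=
  \sum_j `|u 0 j| ^+ 2.

Definition hdot {R : realType} {d : nat} (u v : 'rV[R[i]]_d) : R[i] :=
  \sum_j u 0 j * conjc (v 0 j).

Lemma sqnorm_ge0 (R : realType) (d : nat) (u : 'rV[R[i]]_d) : 0 <= sqnorm u.
Proof. by apply: sumr_ge0 => j _; rewrite exprn_ge0. Qed.

Lemma sqnormZ (R : realType) (d : nat) (c : R[i]) (u : 'rV[R[i]]_d) :
  sqnorm (c *: u) = `|c| ^+ 2 * sqnorm u.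
Proof.
by rewrite /sqnorm mulr_sumr; apply: eq_bigr => j _; rewrite mxE normrM exprMn.
Qed.

Lemma sqnorm_eq0 (R : realType) (d : nat) (u : 'rV[R[i]]_d) :
  sqnorm u = 0 -> u = 0.
Proof.
move=> u0; apply/rowP => j; rewrite mxE; apply/eqP.
have /psumr_eq0P : forall j, true -> 0 <= `|u 0 j| ^+ 2.
  by move=> k _; rewrite exprn_ge0.
by move=> /(_ u0 j isT) /eqP; rewrite expf_eq0 normr_eq0.
Qed.

Lemma sqnorm_lincomb (R : realType) (d : nat) (a b : R[i])
    (p z : 'rV[R[i]]_d) : sqnorm p = 1 -> sqnorm z = 1 ->
  sqnorm (a *: p + b *: z) = `|a| ^+ 2 + `|b| ^+ 2
    + (a * conjc b * hdot p z + conjc a * b * conjc (hdot p z)).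
Proof.
move=> p1 z1.
have -> : sqnorm (a *: p + b *: z) = `|a| ^+ 2 * sqnorm p + `|b| ^+ 2 * sqnorm z
    + (a * conjc b * hdot p z + conjc a * b * conjc (hdot p z)).
  rewrite /sqnorm /hdot rmorph_sum /= !mulr_sumr -!big_split /=.
  apply: eq_bigr => j _; rewrite !mxE !sqr_normc !rmorphD !rmorphM /= conjcK.
  by ring.
by rewrite p1 z1 !mulr1.
Qed.

(** * Homogeneous polynomials on the sphere *)

Lemma peval_scale (R : realType) (d n : nat) (P : mpoly d R[i])
    (c : R[i]) (u : 'rV[R[i]]_d) :
  homogeneous n P -> peval P (c *: u) = c ^+ n * peval P u.
Proof.
move=> /dhomogP hP; rewrite /peval !mevalE mulr_sumr [LHS]big_seq [RHS]big_seq.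
apply: eq_bigr => m /hP /= mn.
under eq_bigr do rewrite mxE exprMn.
by rewrite big_split /= -expr_sum -mdegE mn mulrCA.
Qed.

Lemma peval_line (R : realType) (d : nat) (P : mpoly d R[i])
    (v w : 'rV[R[i]]_d) :
  exists q : {poly R[i]}, forall t, q.[t] = peval P (t *: v + w).
Proof.
exists (\sum_(m <- msupp P) (mcoeff m P)%:P *
  \prod_j ('X * (v 0 j)%:P + (w 0 j)%:P) ^+ (m j)) => t.
rewrite /peval mevalE horner_sum; apply: eq_bigr => m _.
rewrite hornerM hornerC horner_prod; congr (_ * _); apply: eq_bigr => j _.
by rewrite !hornerE !mxE.
Qed.

(** Coordinates that are [(n+1)]-st roots of unity suffice: averaging [P] over
    all such points against the inverse of a monomial of [P] returns its
    coefficient, because all exponents are at most [n]. *)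
Lemma peval_nonzero (R : realType) (d n : nat) (P : mpoly d R[i]) :
  homogeneous n P -> P != 0 -> exists u, peval P u != 0.
Proof.
move=> /dhomogP hP P0.
have [w prim] := exists_primitive_root R[i] n.+1 (ltn0Sn n).
have [m0 m0P] : exists m, m \in msupp P.
  case E : (msupp P) => [|m s]; last by exists m; rewrite mem_head.
  by move/eqP: E; rewrite msupp_eq0 (negbTE P0).
have lt_exp m j : m \in msupp P -> (m j < n.+1)%N.
  by move=> /hP /= <-; rewrite ltnS mdegE (bigD1 j)//= leq_addr.
pose pt (f : {ffun 'I_d -> 'I_n.+1}) : 'rV[R[i]]_d := \row_j w ^+ f j.
case: (boolP [forall f, peval P (pt f) == 0]) => [/forallP all0|]; last first.
  by move=> /forallPn[f fP]; exists (pt f).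
(* If [P] vanished at all these points, so would the average. *)
have : \sum_f peval P (pt f) / \prod_j (w ^+ f j) ^+ (m0 j) = 0.
  by apply: big1 => f _; rewrite (eqP (all0 f)) mul0r.
have -> : \sum_f peval P (pt f) / \prod_j (w ^+ f j) ^+ (m0 j) =
    \sum_(m <- msupp P) mcoeff m P *
      \prod_(j < d) if m j == m0 j then n.+1%:R else 0.
  under eq_bigr do rewrite /peval mevalE mulr_suml.
  rewrite exchange_big /= [LHS]big_seq [RHS]big_seq; apply: eq_bigr => m mP.
  under eq_bigr => f _.
    rewrite -mulrA -prodfV -big_split /=.
    under eq_bigr do rewrite mxE.
    over.
  rewrite -mulr_sumr; congr (_ * _).
  rewrite -(bigA_distr_bigA (fun (j : 'I_d) (k : 'I_n.+1) =>
    (w ^+ k) ^+ (m j) / (w ^+ k) ^+ (m0 j))).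
  by apply: eq_bigr => j _; rewrite (sum_primitive_root _ _ _ _ _ prim) ?lt_exp.
rewrite (bigD1_seq m0) ?msupp_uniq//= [X in _ + X]big1 ?addr0 => [|m /eqP mm0]; last first.
  have [j /negbTE jm] : exists j, m j != m0 j.
    apply/existsP; rewrite -negb_forall; apply/negP => /forallP mE.
    by apply: mm0; apply/mnmP => j; apply/eqP.
  by rewrite (bigD1 j)//= jm mul0r mulr0.
under eq_bigr do rewrite eqxx.
move/eqP; rewrite prodr_const mulf_eq0 expf_eq0 pnatr_eq0 andbF orbF.
by rewrite mcoeff_eq0 m0P.
Qed.

(** The maximality of [p] extended from the sphere to the whole space by
    homogeneity. *)
Lemma peval_le_max (R : realType) (d n : nat) (P : mpoly d R[i])
    (p u : 'rV[R[i]]_d) : (0 < n)%N -> homogeneous n P -> max_modulus_at P p ->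
  `|peval P u| ^+ 2 <= `|peval P p| ^+ 2 * sqnorm u ^+ n.
Proof.
move=> n0 hP [_ maxp].
have [s0|s0] := eqVneq (sqnorm u) 0.
  have u0 := sqnorm_eq0 _ _ _ s0.
  have -> : peval P u = 0.
    by rewrite u0 -(scale0r (0 : 'rV_d)) (peval_scale _ _ _ _ _ _ hP) expr0n
      gtn_eqF// mul0r.
  by rewrite normr0 expr0n mulr_ge0 ?exprn_ge0 ?sqnorm_ge0.
have spos : 0 < sqnorm u by rewrite lt_def s0 sqnorm_ge0.
have c0 : 0 < sqrtC (sqnorm u) by rewrite sqrtC_gt0.
pose v := (sqrtC (sqnorm u))^-1 *: u.
have v1 : unit_sphere v.
  rewrite /unit_sphere /= -/(sqnorm v) sqnormZ normfV ger0_norm ?ltW//.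
  by rewrite exprVn sqrtCK mulVf.
have uE : u = sqrtC (sqnorm u) *: v by rewrite scalerA divff ?scale1r ?gt_eqF.
rewrite {1}uE (peval_scale _ _ _ _ _ _ hP) normrM exprMn normrX exprAC.
rewrite (ger0_norm (ltW c0)) sqrtCK mulrC ler_wpM2r ?exprn_ge0 ?sqnorm_ge0//.
by rewrite lerXn2r ?nnegrE// maxp.
Qed.

Lemma peval_max_neq0 (R : realType) (d n : nat) (P : mpoly d R[i])
    (p : 'rV[R[i]]_d) : (0 < n)%N -> homogeneous n P -> P != 0 ->
  max_modulus_at P p -> peval P p != 0.
Proof.
move=> n0 hP P0 maxp; have [u u0] := peval_nonzero _ _ _ _ hP P0.
apply: contra_neq u0 => p0.
have := peval_le_max _ _ _ _ _ u n0 hP maxp.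
rewrite p0 normr0 expr0n mul0r => le0; apply/eqP.
by rewrite -normr_eq0 -sqrf_eq0 eq_le le0 exprn_ge0.
Qed.

(** * The angle between a maximum and a zero *)

(** The bound on [|q|] becomes one on [|q / 'X|] along the circle of squared
    radius [t], gaining a factor [t^-1], and the maximum principle carries it to
    the point 1, where [q] and [q / 'X] agree. *)
Lemma growth_along_line (R : realType) (n : nat) (q : {poly R[i]}) (b t : R) :
  q.[0] = 0 -> q.[1] != 0 ->
  (forall z, `|q.[z]| ^+ 2
     <= `|q.[1]| ^+ 2 * ((1 - b)%:C + b%:C * `|z| ^+ 2)%C ^+ n) ->
  1 < t -> t <= (1 - b + b * t) ^+ n.
Proof.
move=> q0 q1 bnd t1.
have /factor_theorem[h hE] : root q 0 by apply/eqP.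
have {}hE z : q.[z] = z * h.[z].
  by rewrite hE hornerM hornerXsubC subr0 mulrC.
pose T : R[i] := sqrtC t%:C%C.
have t0 : 0 < t by apply: lt_trans t1.
have tC0 : 0 <= t%:C%C by rewrite -(rmorph0 (real_complex R)) lecR ltW.
have T2 : T ^+ 2 = t%:C%C by rewrite sqrtCK.
have T0 : 0 <= T by rewrite sqrtC_ge0.
have T1 : 1 < T.
  rewrite -(@ltr_pXn2r _ 2)// ?nnegrE// ?T2 ?expr1n.
  by rewrite -(rmorph1 (real_complex R)) ltcR.
set m := 1 - b + b * t.
have onT z : `|z| = T ->
    (`|h.[z]| ^+ 2 <= `|q.[1]| ^+ 2 * (m ^+ n)%:C / t%:C)%C.
  move=> zT; have := bnd z.
  rewrite hE normrM zT exprMn T2 -rmorphM -rmorphD -rmorphXn /= -/m.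
  by rewrite mulrC ler_pdivlMr// -(rmorph0 (real_complex R)) ltcR.
have M20 : (0 <= `|q.[1]| ^+ 2 * (m ^+ n)%:C / t%:C)%C.
  by apply: le_trans (onT T _); rewrite ?exprn_ge0// ger0_norm.
have : (`|h.[1]| <= sqrtC (`|q.[1]| ^+ 2 * (m ^+ n)%:C / t%:C))%C.
  apply: (maximum_modulus_at_1 _ _ _ _ T1) => z /onT le.
  by rewrite -(@ler_pXn2r _ 2) // ?nnegrE ?sqrtC_ge0// sqrtCK.
rewrite -(@ler_pXn2r _ 2) // ?nnegrE ?sqrtC_ge0// sqrtCK.
have -> : h.[1] = q.[1] by rewrite hE mul1r.
rewrite ler_pdivlMr -?(rmorph0 (real_complex R)) ?ltcR//.
by rewrite ler_pM2l ?exprn_gt0 ?normr_gt0// lecR.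
Qed.

(** Both sides of the hypothesis equal 1 at [t = 1], so their slopes there, 1 and
    [n b], compare.  Instead of a derivative, a single value of [t] is used. *)
Lemma one_le_of_growth (R : realType) (n : nat) (b : R) : 0 <= b ->
  (forall t, 1 < t -> t <= (1 - b + b * t) ^+ n) -> 1 <= n%:R * b.
Proof.
move=> b0 growth.
(* Bernoulli's inequality for [(1 + x)^-1], in multiplied-out form. *)
have bern (x : R) : 0 <= x -> (1 + x) ^+ n * (1 - n%:R * x) <= 1.
  move=> x0; elim: n {growth} => [|k IH]; first by rewrite mul0r subr0 mulr1.
  apply: le_trans IH; rewrite exprSr -mulrA ler_wpM2l ?exprn_ge0 ?addr_ge0//.
  rewrite -natr1; have : 0 <= (k%:R + 1) * x ^+ 2 :> R.
    by rewrite mulr_ge0 ?sqr_ge0 ?addr_ge0.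
  nra.
rewrite leNgt; apply/negP => nb.
set c := n%:R * b in nb *.
have c0 : 0 <= c by rewrite mulr_ge0.
(* At [t = 2 - c] the growth bound and Bernoulli's inequality combine into
   [(1 - c)^3 <= 0]. *)
have := growth (1 + (1 - c)) ltac:(lra).
have -> : 1 - b + b * (1 + (1 - c)) = 1 + b * (1 - c) by ring.
have := bern (b * (1 - c)) ltac:(nra).
rewrite mulrA -/c; set X := (1 + _) ^+ n => h1 h2.
have D0 : 0 < 1 - c * (1 - c) by nra.
have := ler_wpM2r (ltW D0) h2.
have : 0 < (1 - c) ^+ 3 by rewrite exprn_gt0 ?subr_gt0.
nra.
Qed.

(** The bound is on the modulus of the Hermitian product, which controls the
    angle between the complex lines of [p] and [z] and hence is stronger than a
    bound on its real part. *)
Lemma sqr_hdot_le (R : realType) (d n : nat) (P : mpoly d R[i])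
    (p z : 'rV[R[i]]_d) : (0 < n)%N -> homogeneous n P -> P != 0 ->
  max_modulus_at P p -> unit_sphere z -> peval P z = 0 ->
  n%:R * (complex.Re (hdot p z) ^+ 2 + complex.Im (hdot p z) ^+ 2)
    <= n%:R - 1 :> R.
Proof.
move=> n0 hP P0 maxp z1 Pz; have [p1 _] := maxp.
set y := hdot p z; set a := (_ + _ : R).
have aE : (a%:C)%C = `|y| ^+ 2 by rewrite /a add_Re2_Im2.
(* Pythagoras for the orthogonal vectors [p - y z] and [y z]. *)
have sq t : sqnorm (t *: (p - y *: z) + y *: z) =
    ((1 - (1 - a))%:C + (1 - a)%:C * `|t| ^+ 2)%C.
  have -> : t *: (p - y *: z) + y *: z = t *: p + ((1 - t) * y) *: z.
    by rewrite scalerBr scalerA -addrA -scaleNr -scalerDl mulrBl mul1r addrC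
      [- _ + _]addrC addrC.
  rewrite sqnorm_lincomb// -/y subKr rmorphB rmorph1 aE !sqr_normc.
  by rewrite !rmorphM !rmorphB !rmorph1 /= aE sqr_normc; ring.
have b0 : 0 <= 1 - a.
  have := sqnorm_ge0 _ _ (p - y *: z).
  have -> : p - y *: z = 1 *: p + (- y) *: z by rewrite scale1r scaleNr.
  rewrite sqnorm_lincomb// -/y => h; rewrite -lecR rmorph0 rmorphB rmorph1 /= aE.
  apply: (le_trans h); rewrite le_eqVlt; apply/orP; left; apply/eqP.
  by rewrite !sqr_normc !rmorphN !rmorph1 /=; ring.
have [q qE] := peval_line _ _ P (p - y *: z) (y *: z).
have q1 : q.[1] = peval P p by rewrite qE scale1r subrK.
have : 1 <= n%:R * (1 - a).
  apply: one_le_of_growth => // t; apply: (growth_along_line _ _ q).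
  - by rewrite qE scale0r add0r (peval_scale _ _ _ _ _ _ hP) Pz mulr0.
  - by rewrite q1 (peval_max_neq0 _ _ _ _ _ n0 hP).
  - by move=> s; rewrite q1 qE -sq peval_le_max.
lra.
Qed.

Theorem theorem1p2 (R : realType) (d n : nat) (P : mpoly d R[i])
    (p : 'rV[R[i]]_d) :
  (1 <= d)%N -> (1 <= n)%N ->
  homogeneous n P -> P != 0 ->
  max_modulus_at P p ->
  at_angular_dist_ge p (asin (1 / Num.sqrt n%:R))
    (zero_set P `&` unit_sphere).
Proof.
move=> _ n0 hP P0 maxp z [Pz z1].
have := sqr_hdot_le _ _ _ _ _ _ n0 hP P0 maxp z1 Pz.
rewrite /angular_dist -/(hdot p z).
set c := complex.Re _; set e := complex.Im _ => le_sq.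
have n1 : 1 <= n%:R :> R by rewrite ler1n.
set s := 1 / Num.sqrt n%:R.
have s2 : s ^+ 2 = n%:R^-1 by rewrite expr_div_n expr1n sqr_sqrtr// div1r.
have s0 : 0 <= s by rewrite divr_ge0 ?sqrtr_ge0 ?ler01.
have ns : n%:R * s ^+ 2 = 1 by rewrite s2 divff// pnatr_eq0 -lt0n.
have s1 : s <= 1 by nra.
have sI : -1 <= s <= 1 by lra.
have c2 : c ^+ 2 <= 1 - s ^+ 2.
  have : n%:R * (1 - s ^+ 2 - c ^+ 2) >= 0.
    have : 0 <= n%:R * e ^+ 2 by rewrite mulr_ge0 ?sqr_ge0.
    lra.
  by rewrite pmulr_rge0 ?subr_ge0//; lra.
have cI : -1 <= c <= 1 by have := sqr_ge0 s; nra.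
rewrite leNgt; apply/negP => lt_acos.
have asin_le : asin s <= pi.
  by have := asin_lepi2 sI; have := pi_gt0 R; lra.
have := lt_acos; rewrite -ltr_cos ?in_itv /=; last 2 first.
- by rewrite acos_ge0// acos_lepi.
- by rewrite asin_le (le_trans _ (ltW lt_acos))// acos_ge0.
rewrite cos_asin// acosK ?in_itv//= ltNge => /negP; apply.
apply: (le_trans (ler_norm c)); rewrite -sqrtr_sqr ler_wsqrtr//.
Qed.
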